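(* For all connected simply connected complex semisimple Lie groups $G$ and $(v,w)\in\mathcal{ECR}(W)$, with $d=l(w)-l(v)$, the Bruhat interval $[v,w]$ in $W$ is isomorphic to the power set of $\{1,\dots,d\}$ with the reverse order, i.e. the poset of subsets of $\{1,\dots,d\}$ ordered by reverse inclusion. In other words, all elements $w'\in W$ with $v\le w'\le w$ are of the form $w'=w_K$ for some $K\subseteq\{1,\dots,d\}$, and $$w_K\le w_J\iff K\supseteq J.$$
   Context: $B_\pm$ are fixed opposite Borel subgroups of $G$, $T=B_+\cap B_-$, $\mathfrak t=\mathrm{Lie}\,T$; $\Delta_+$ is the set of positive roots, $\alpha_i$ the simple roots; $W=N_G(T)/T$ acts on $\mathfrak t^*$ with $W$-invariant form $(\cdot,\cdot)$, $s_\beta$ is the reflection in $\beta$, $s_i=s_{\alpha_i}$, $l$ is the length, $\le$ the Bruhat order. $\mathcal{ECR}(W)$ is the set of pairs $(v,w)$ with $v\le w$ and $\dim\operatorname{Ker}(vw^{-1}+1)=l(w)-l(v)$ (kernel in $\mathfrak t^*$). Equivalently, for any reduced word $(i_1,\dots,i_l)$ of $w$, with $\beta_k:=s_{i_1}\cdots s_{i_{k-1}}(\alpha_{i_k})$, there are positions $p_1<\dots<p_d$, $d=l(w)-l(v)$, such that deleting $i_{p_1},\dots,i_{p_d}$ gives a reduced word of $v$ and $\beta_{p_j}\perp\beta_{p_k}$ for $j\ne k$. Fix such a reduced word and such positions. For $K\subseteq\{1,\dots,d\}$, $w_K:=\big(\prod_{j\in K}s_{\beta_{p_j}}\big)w$,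 which is the product of simple reflections obtained from $s_{i_1}\cdots s_{i_l}$ by deleting the factors in positions $p_k$, $k\in K$. In particular $w_\varnothing=w$ and $w_{\{1,\dots,d\}}=v$. *)

(* Defs.v *)
From mathcomp Require Import all_boot all_order all_algebra.
From mathcomp Require Import sesquilinear complex boolp reals.

Set Implicit Arguments.
Unset Strict Implicit.
Unset Printing Implicit Defensive.

Import Order.TTheory GRing.Theory Num.Theory.
Local Open Scope ring_scope.
Local Open Scope complex_scope.

(* A connected simply connected complex semisimple Lie group G with opposite
   Borel subgroups B+ and B- enters through the reduced crystallographic root
   system it defines in the complex vector space V = t^*, together with the
   base (simple roots) determined by B+ and a W-invariant form on t^*.  Every
   based_root_system arises from such a G, unique up to isomorphism.

   The form is C-bilinear and symmetric on t^*, and positive definite on the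
   real span of the roots.  Its invariance under W is automatic: by
   root_reflection below, W is generated by reflections that are orthogonal
   for it. *)

Definition root_reflection_fun (R : realType) (V : vectType R[i])
    (B : {symmetric V}) (b x : V) : V := x - (2 * B x b / B b b) *: b.

Record based_root_system (R : realType) (V : vectType R[i]) := BasedRootSystem {
  form : {symmetric V};
  roots : seq V;
  simple_roots : (\dim {:V}).-tuple V;
  roots_neq0 : 0 \notin roots;
  roots_span : <<roots>>%VS = fullv;
  form_pos : forall c : V -> R,
    let x := \sum_(b <- roots) (c b)%:C *: b in x != 0 -> 0 < form x x;
  roots_refl : forall a b,
    a \in roots -> b \in roots -> root_reflection_fun form b a \in roots;
  roots_int : forall a b,
    a \in roots -> b \in roots -> exists m : int, 2 * form a b / form b b = m%:~R;
  roots_reduced : forall (a : V) (c : R[i]),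
    a \in roots -> c *: a \in roots -> c = 1 \/ c = -1;
  simple_basis : basis_of fullv simple_roots;
  simple_in_roots : forall i, tnth simple_roots i \in roots;
  simple_base : forall a, a \in roots ->
    exists c : 'I_(\dim {:V}) -> nat,
      a = \sum_i (c i)%:R *: tnth simple_roots i \/
      a = - \sum_i (c i)%:R *: tnth simple_roots i
}.

Section WeylGroup.

Variables (R : realType) (V : vectType R[i]) (D : based_root_system V).

Local Notation index := 'I_(\dim {:V}).
Local Notation comp := (@comp_lfun _ V V V).

Definition reflection (b : V) : 'End(V) := linfun (root_reflection_fun (form D) b).

Definition weyl (w : 'End(V)) : Prop :=
  exists2 s : seq V, {subset s <= roots D} &
    w = \big[comp / \1%VF]_(b <- s) reflection b.

Definition simple_root (i : index) : V := tnth (simple_roots D) i.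

Definition word_prod (s : seq index) : 'End(V) :=
  \big[comp / \1%VF]_(i <- s) reflection (simple_root i).

Definition has_word (w : 'End(V)) (n : nat) : bool :=
  [exists s : n.-tuple index, word_prod s == w].

(* The default value 0 is never used on W, which the simple reflections
   generate. *)
Definition weyl_length (w : 'End(V)) : nat :=
  if pselect (exists n, has_word w n) is left h then ex_minn h else 0%N.

Definition reduced_word (s : seq index) (w : 'End(V)) : Prop :=
  word_prod s = w /\ size s = weyl_length w.

Inductive bruhat (u : 'End(V)) : 'End(V) -> Prop :=
| bruhat_refl : bruhat u u
| bruhat_step x b : bruhat u x -> b \in roots D ->
    (weyl_length x < weyl_length (reflection b \o x)%VF)%N ->
    bruhat u (reflection b \o x)%VF.

Definition bruhat_interval (v w x : 'End(V)) : Prop :=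
  [/\ weyl x, bruhat v x & bruhat x w].

Definition ECR (v w : 'End(V)) : Prop :=
  [/\ weyl v, weyl w, bruhat v w &
      \dim (lker ((v \o w^-1) + \1)%VF) = (weyl_length w - weyl_length v)%N].

(* Positions in words are numbered from 0, so that beta s k is the root
   beta_(k+1) of the usual 1-based numbering. *)
Definition beta (l : nat) (s : l.-tuple index) (k : 'I_l) : V :=
  word_prod (take k s) (simple_root (tnth s k)).

Definition delete (l : nat) (s : l.-tuple index) (P : {set 'I_l}) : seq index :=
  [seq tnth s k | k <- enum (~: P)].

Definition ECR_positions (l d : nat) (v w : 'End(V)) (s : l.-tuple index)
    (p : 'I_d -> 'I_l) : Prop :=
  [/\ reduced_word s w,
      {homo p : j k / (j < k)%N},
      reduced_word (delete s [set p j | j : 'I_d]) v &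
      forall j k, j != k -> form D (beta s (p j)) (beta s (p k)) = 0].

Definition w_sub (l d : nat) (w : 'End(V)) (s : l.-tuple index)
    (p : 'I_d -> 'I_l) (K : {set 'I_d}) : 'End(V) :=
  ((\big[comp / \1]_(j in K) reflection (beta s (p j))) \o w)%VF.

End WeylGroup.

Definition poset_iso (T U : Type) (leT : T -> T -> Prop) (leU : U -> U -> Prop)
    (A : U -> Prop) (f : T -> U) : Prop :=
  [/\ injective f,
      forall y, A y <-> exists x, f x = y &
      forall x x', leT x x' <-> leU (f x) (f x')].

(* Main.v *)
Require Import Defs.
From HB Require Import structures.
From mathcomp Require Import all_boot all_order all_algebra.
From mathcomp Require Import sesquilinear complex boolp reals ring.

(** Write the reduced word of [w] as [i :: s], with simple reflection [r] for
    its first letter, and let [v'], [w'] be the elements whose words are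
    obtained by dropping that letter from the words of [v] and [w]. The
    theorem follows by induction on the word ([boolean_interval]), the
    lifting property of the Bruhat order ([bruhat_simple_up],
    [bruhat_simple_down], [bruhat_simple_mid]) comparing the interval from
    [v] to [w] with the smaller interval from [v'] to [w'].

    If the first letter is one of the marked, deletable ones, then [v = v']
    and [w = r w']. Its root [alpha] is orthogonal to the roots of the other
    marked letters, so [r] increases the length of every element of the
    smaller interval; by lifting, the large interval is the union of the
    smaller one and of its translate by [r]. If the first letter is not
    marked, then [v = r v'] and [w = r w'], and the large interval is the
    translate of the smaller one.

    What has to be excluded in both cases is an edge [x, r x] of the Bruhat
    graph with both ends in the smaller interval. By induction both ends are
    products of reflections in marked roots with [w'], so [alpha] lies in the
    span of the marked roots ([refl_prod_opp_simple]). On that span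
    [v' w'^-1] is [-1], because the marked roots are orthogonal; then the
    preimages of [alpha] under [v'] and [w'] are opposite roots, whereas both
    are positive, since [r] increases the lengths of [v'] and [w']
    ([no_simple_edge]).

    Positions with orthogonal roots exist for every pair in ECR: the subword
    property gives [v w^-1] as a product of [d] reflections; the
    [-1]-eigenspace of such a product is contained in the span of the [d]
    roots, so dimension [d] forces these roots to be linearly independent and
    to be negated by the product, which happens only if they are orthogonal
    ([orthogonal_of_dim]).

    The combinatorics of the Weyl group used here rests on two facts: a
    simple reflection permutes the positive roots other than its own root
    ([simple_refl_pos]), and [refl b] shortens [w] exactly when [w] sends a
    negative root to the positive root [b] ([refl_down], [refl_up]). *)

Set Implicit Arguments.
Unset Strict Implicit.
Unset Printing Implicit Defensive.

Import Order.TTheory GRing.Theory Num.Theory.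
Local Open Scope ring_scope.

Section RootSystem.

Variables (R : realType) (V : vectType R[i]) (D : based_root_system V).

Local Notation index := 'I_(\dim {:V}).
Local Notation dot := (Defs.form D).
Local Notation Phi := (Defs.roots D).
Local Notation refl := (reflection D).
Local Notation alpha := (simple_root D).
Local Notation wp := (word_prod D).
Local Notation len := (weyl_length D).
Local Notation comp := (@comp_lfun _ V V V).

(** * Reflections *)

Lemma dotC x y : dot x y = dot y x.
Proof. by rewrite hermC /= expr0 mul1r. Qed.

Lemma root_reflection_fun_is_linear b : linear (root_reflection_fun dot b).
Proof.
move=> a x y; rewrite /root_reflection_fun linearDl /= linearZl_LR /=.
rewrite scalerBr addrACA -opprD scalerA -scalerDl; congr (_ - _ *: _).
by rewrite mulrDr mulrDl !mulrA [2 * a]mulrC.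
Qed.

Lemma reflE b x : refl b x = x - (2 * dot x b / dot b b) *: b.
Proof.
pose lin := GRing.isLinear.Build _ _ _ _ _ (root_reflection_fun_is_linear b).
pose f : {linear V -> V} := HB.pack (root_reflection_fun dot b) lin.
exact: (lfunE f).
Qed.

(** A root is a real combination of roots, so positivity of the form on the real
    span applies to it; the multiplicity of [b] in the list of roots appears
    because that combination is written as a sum over the list. *)
Lemma root_dot_gt0 b : b \in Phi -> 0 < dot b b.
Proof.
move=> bPhi; have b0 : b != 0 by apply: contraNneq (roots_neq0 D) => <-.
pose n := count_mem b Phi.
have n0 : (n > 0)%N by rewrite -has_count has_pred1.
have := @form_pos _ _ D (fun x => (x == b)%:R).
rewrite /=; have -> : \sum_(x <- Phi) ((x == b)%:R : R)%:C%C *: x = n%:R *: b.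
  rewrite (bigID (pred1 b)) /= [X in _ + X]big1 ?addr0; last first.
    by move=> x /negPf ->; rewrite scale0r.
  rewrite (eq_bigr (fun=> b)); last by move=> x /eqP ->; rewrite eqxx scale1r.
  by rewrite big_const_seq iter_addr_0 scaler_nat.
rewrite /= scaler_eq0 negb_or b0 pnatr_eq0 -lt0n n0 => /(_ isT).
rewrite linearZl_LR /= linearZr_LR /= mulrA pmulr_rgt0 //.
by rewrite mulr_gt0 // ltr0n.
Qed.

Lemma root_dot_neq0 b : b \in Phi -> dot b b != 0.
Proof. by move=> /root_dot_gt0/lt0r_neq0. Qed.

Lemma refl_orth b x : dot x b = 0 -> refl b x = x.
Proof. by move=> xb; rewrite reflE xb mulr0 mul0r scale0r subr0. Qed.

Lemma refl_self b : b \in Phi -> refl b b = - b.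
Proof.
move=> /root_dot_neq0 b0.
by rewrite reflE mulfK // scaler_nat mulr2n opprD addNKr.
Qed.

Lemma reflK b : b \in Phi -> involutive (refl b).
Proof.
move=> bPhi x; rewrite [refl b x]reflE linearB linearZ /= refl_self // reflE.
by rewrite scalerN opprK subrK.
Qed.

Lemma reflKf b (w : 'End(V)) : b \in Phi -> (refl b \o (refl b \o w))%VF = w.
Proof. by move=> bPhi; apply/lfunP => x; rewrite !comp_lfunE reflK. Qed.

Lemma refl_isometry b x y : b \in Phi -> dot (refl b x) (refl b y) = dot x y.
Proof.
move=> bPhi; have b0 := root_dot_neq0 bPhi.
rewrite {1}reflE linearBl linearZl_LR /=.
suff ->: dot b (refl b y) = - dot b y.
  by rewrite reflE linearBr linearZr_LR /= (dotC b y); field.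
rewrite reflE linearBr linearZr_LR /= mulfVK // (dotC b y) mulr_natl mulr2n.
by rewrite opprD addNKr.
Qed.

Lemma refl_dot b x y : b \in Phi -> dot (refl b x) y = dot x (refl b y).
Proof. by move=> bPhi; rewrite -{1}[y](reflK bPhi) refl_isometry. Qed.

Lemma refl_opp b : refl (- b) = refl b.
Proof.
apply/lfunP => x; rewrite !reflE !linearNr linearNl opprK.
by rewrite mulrN mulNr scalerN scaleNr opprK.
Qed.

Lemma refl_conj a b x : a \in Phi ->
  refl (refl a b) x = refl a (refl b (refl a x)).
Proof.
move=> aPhi; rewrite reflE [refl b _]reflE [in RHS]linearB [in RHS]linearZ /=.
rewrite reflK //.
by rewrite refl_isometry // -(refl_dot x).
Qed.

Lemma refl_root a b : a \in Phi -> b \in Phi -> refl b a \in Phi.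
Proof. by move=> aPhi bPhi; rewrite reflE; apply: roots_refl. Qed.

Lemma opp_root b : b \in Phi -> - b \in Phi.
Proof. by move=> bPhi; rewrite -refl_self // refl_root. Qed.

Lemma alpha_root i : alpha i \in Phi.
Proof. exact: simple_in_roots. Qed.
#[local] Hint Resolve alpha_root : core.

(** * Positive roots *)

(** For a root the coordinates are integers of one sign, so nonnegativity of
    all of them is the usual notion of a positive root. Stated through
    coordinates it is decidable. *)
Definition pos (x : V) : bool :=
  [forall i, 0 <= (coord (simple_roots D) i x : R[i])].

Lemma simple_free : free (simple_roots D).
Proof. exact: basis_free (simple_basis D). Qed.

Lemma coord_simple_sum (c : index -> R[i]) j :
  coord (simple_roots D) j (\sum_i c i *: alpha i) = c j.
Proof.
rewrite -[RHS](coord_sum_free c j simple_free); congr (coord _ _ _).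
by apply: eq_bigr => i _; rewrite /simple_root (tnth_nth 0).
Qed.

Lemma root_pos_sum b : b \in Phi -> pos b ->
  exists c : index -> nat, b = \sum_i (c i)%:R *: alpha i.
Proof.
move=> bPhi /forallP pb; have [c [bE|bE]] := simple_base bPhi; exists c => //.
have c0 j : (c j)%:R = 0 :> R[i].
  have := pb j; rewrite bE linearN /= coord_simple_sum oppr_ge0 => cj.
  by apply/le_anti; rewrite cj ler0n.
by rewrite bE -sumrN; apply: eq_bigr => i _; rewrite c0 scale0r oppr0.
Qed.

Lemma sum_pos (c : index -> nat) : pos (\sum_i (c i)%:R *: alpha i).
Proof. by apply/forallP => j; rewrite coord_simple_sum ler0n. Qed.

Lemma pos_or_neg b : b \in Phi -> pos b || pos (- b).
Proof.
move=> bPhi; have [c [->|->]] := simple_base bPhi; rewrite ?opprK sum_pos //.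
by rewrite orbT.
Qed.

Lemma pos_opp b : b \in Phi -> pos (- b) = ~~ pos b.
Proof.
move=> bPhi; have := pos_or_neg bPhi.
case: (boolP (pos b)) => // /forallP pb _; apply/negbTE/negP => /forallP nb.
have /negP := roots_neq0 D; apply; suff <- : b = 0 by [].
have bV : b \in <<simple_roots D>>%VS.
  by rewrite (span_basis (simple_basis D)) memvf.
rewrite (coord_span bV) big1 // => i _.
suff -> : coord (simple_roots D) i b = 0 by rewrite scale0r.
have := nb i; rewrite linearN /= oppr_ge0 => h.
by apply/le_anti/andP; split; [exact: h | exact: pb].
Qed.

Lemma alpha_pos i : pos (alpha i).
Proof.
rewrite (_ : alpha i = \sum_j ((j == i)%:R : nat)%:R *: alpha j) ?sum_pos //.
rewrite (bigD1 i) //= eqxx scale1r big1 ?addr0 // => j /negPf ->.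
by rewrite scale0r.
Qed.

(** A positive root that is not [alpha i] has a positive coordinate at some
    other simple root, since roots are not proper multiples of each other;
    [refl (alpha i)] leaves that coordinate unchanged. *)
Lemma simple_refl_pos i b : b \in Phi -> pos b -> b != alpha i ->
  pos (refl (alpha i) b).
Proof.
move=> bPhi pb bi; have [c bE] := root_pos_sum bPhi pb.
have sbPhi : refl (alpha i) b \in Phi by rewrite refl_root.
suff [j ij cj] : exists2 j, j != i & c j != 0%N.
  apply/negPn; rewrite -pos_opp //; apply/negP => /forallP /(_ j).
  rewrite reflE bE opprD opprK linearD linearN linearZ /= coord_simple_sum.
  have -> : coord (simple_roots D) j (alpha i) = 0.
    rewrite /simple_root (tnth_nth 0) (coord_free _ _ simple_free).
    by rewrite 1?eq_sym (negPf ij).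
  by rewrite mulr0 addr0 oppr_ge0 lern0 (negPf cj).
case: (pickP [pred j | (j != i) && (c j != 0%N)]) => [j /andP[]|noj].
  by exists j.
have bci : b = (c i)%:R *: alpha i.
  rewrite bE (bigD1 i) //= big1 ?addr0 // => j ij.
  by have := noj j; rewrite /= ij => /negbFE/eqP ->; rewrite scale0r.
have [c1|c1] : (c i)%:R = 1 :> R[i] \/ (c i)%:R = -1 :> R[i].
- by apply: (@roots_reduced _ _ D (alpha i)) => //; rewrite -bci.
- by case/eqP: bi; rewrite bci c1 scale1r.
- have : 0 <= -1 :> R[i] by rewrite -c1 ler0n.
  by rewrite oppr_ge0 ler10.
Qed.

(** * The Weyl group and its words *)

Definition refl_prod (L : seq V) : 'End(V) :=
  \big[comp / \1%VF]_(b <- L) refl b.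

Lemma refl_prod_cons b L : refl_prod (b :: L) = (refl b \o refl_prod L)%VF.
Proof. by rewrite /refl_prod big_cons. Qed.

Lemma refl_prod_cat L1 L2 :
  refl_prod (L1 ++ L2) = (refl_prod L1 \o refl_prod L2)%VF.
Proof.
elim: L1 => [|b L1 IH] /=; first by rewrite {2}/refl_prod big_nil comp_lfun1l.
by rewrite !refl_prod_cons IH comp_lfunA.
Qed.

Lemma refl_prod_nil x : refl_prod [::] x = x.
Proof. by rewrite /refl_prod big_nil id_lfunE. Qed.

Lemma word_prodE s : wp s = refl_prod (map alpha s).
Proof. by rewrite /refl_prod big_map. Qed.

Lemma word_prod_cons i s : wp (i :: s) = (refl (alpha i) \o wp s)%VF.
Proof. by rewrite /word_prod big_cons. Qed.

Lemma word_prod_cat s t : wp (s ++ t) = (wp s \o wp t)%VF.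
Proof. by rewrite !word_prodE map_cat refl_prod_cat. Qed.

Lemma simple_subset s : {subset map alpha s <= Phi}.
Proof. by move=> _ /mapP[i _ ->]. Qed.

Lemma weyl_refl_prod L : {subset L <= Phi} -> weyl D (refl_prod L).
Proof. by move=> LPhi; exists L. Qed.

Lemma weyl_word s : weyl D (wp s).
Proof. by rewrite word_prodE; apply/weyl_refl_prod/simple_subset. Qed.

Lemma weyl_refl b w : b \in Phi -> weyl D w -> weyl D (refl b \o w)%VF.
Proof.
move=> bPhi [L LPhi ->]; exists (b :: L); last by rewrite big_cons.
by move=> x; rewrite inE => /predU1P[->|/LPhi].
Qed.

Lemma weyl_ind (P : 'End(V) -> Prop) : P \1%VF ->
  (forall b w, b \in Phi -> weyl D w -> P w -> P (refl b \o w)%VF) ->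
  forall w, weyl D w -> P w.
Proof.
move=> P1 Ps w [L LPhi ->]; elim: L LPhi => [|b L IH] LPhi; rewrite ?big_nil //.
have LPhi' : {subset L <= Phi} by move=> x xL; apply: LPhi; rewrite inE xL orbT.
rewrite big_cons; apply: Ps; last exact: IH; first by apply/LPhi/mem_head.
exact: weyl_refl_prod.
Qed.

Lemma weyl_root w b : weyl D w -> b \in Phi -> w b \in Phi.
Proof.
move=> ww; elim/weyl_ind: w / ww b => [|a w aPhi _ IH] b bPhi.
  by rewrite id_lfunE.
by rewrite comp_lfunE refl_root // IH.
Qed.

Lemma weyl_surj w x : weyl D w -> exists y, w y = x.
Proof.
move=> ww; elim/weyl_ind: w / ww x => [|a w aPhi _ IH] x.
  by exists x; rewrite id_lfunE.
by have [y yE] := IH (refl a x); exists y; rewrite comp_lfunE yE reflK.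
Qed.

Lemma weyl_inj w : weyl D w -> injective w.
Proof.
move=> ww; elim/weyl_ind: w / ww => [|a w aPhi _ IH] x y; rewrite ?id_lfunE //.
by rewrite !comp_lfunE => /(can_inj (reflK aPhi)) /IH.
Qed.

Lemma weyl_preimage w b : weyl D w -> b \in Phi ->
  exists2 a, a \in Phi & w a = b.
Proof.
move=> ww; elim/weyl_ind: w / ww b => [|a w aPhi _ IH] b bPhi.
  by exists b; rewrite ?id_lfunE.
have [c cPhi cE] := IH (refl a b) (refl_root bPhi aPhi).
by exists c; rewrite // comp_lfunE cE reflK.
Qed.

Lemma root_dot_real a b : a \in Phi -> b \in Phi -> dot a b \is Num.real.
Proof.
move=> aPhi bPhi; have [m mE] := roots_int aPhi bPhi.
have b0 := root_dot_gt0 bPhi.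
have -> : dot a b = m%:~R * dot b b / 2.
  by rewrite -mE; field; rewrite lt0r_neq0.
by rewrite rpredM ?rpredV ?rpredM ?realz ?gtr0_real // ltr0n.
Qed.

(** Otherwise [dot b b], a nonnegative combination of the products of [b] with
    the simple roots, would not be positive.  These products are real by
    integrality, which makes them comparable with [0]. *)
Lemma root_dot_simple_gt0 b : b \in Phi -> pos b ->
  exists i, 0 < dot b (alpha i).
Proof.
move=> bPhi pb; have [c bE] := root_pos_sum bPhi pb.
case: (pickP [pred i | 0 < dot b (alpha i)]) => [i|noi]; first by exists i.
have := root_dot_gt0 bPhi; suff /le_gtF -> : dot b b <= 0 by [].
rewrite {2}bE linear_sumr /= sumr_le0 // => i _.
rewrite linearZr_LR /= mulr_ge0_le0 ?ler0n //.
by rewrite real_leNgt ?root_dot_real ?real0 //; have /= -> := noi i.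
Qed.

(** Subtracting a simple root with which [b] has positive product lowers the
    height of [b], so that conjugating by the simple reflections eventually
    turns the reflection in [b] into a simple one. *)
Lemma refl_is_word b : b \in Phi -> exists s, wp s = refl b.
Proof.
wlog pb : b / pos b => [posP bPhi|].
  case/orP: (pos_or_neg bPhi) => [|/posP]; first by move/posP; apply.
  by rewrite refl_opp; apply; exact: opp_root.
move=> bPhi; have [c bE] := root_pos_sum bPhi pb.
have [n] := ubnP (\sum_i c i); elim: n => // n IH in b c bE bPhi pb *.
rewrite ltnS => cn; have [i bi] := root_dot_simple_gt0 bPhi pb.
have [->|b_i] := eqVneq b (alpha i).
  by exists [:: i]; rewrite word_prod_cons /word_prod big_nil comp_lfun1r.
pose b' := refl (alpha i) b.
have b'Phi : b' \in Phi by rewrite refl_root.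
have pb' : pos b' by apply: simple_refl_pos.
have [c' b'E] := root_pos_sum b'Phi pb'.
(* The height is taken in the field of scalars, where it is linear. *)
pose ht x := \sum_j (coord (simple_roots D) j x : R[i]).
have htE (k : index -> nat) : ht (\sum_j (k j)%:R *: alpha j) = (\sum_j k j)%:R.
  by rewrite natr_sum; apply: eq_bigr => j _; rewrite coord_simple_sum.
have ht_alpha : ht (alpha i) = 1.
  rewrite /ht (bigD1 i) //= /simple_root (tnth_nth 0).
  rewrite (coord_free _ _ simple_free) eqxx big1 ?addr0 // => j ji.
  by rewrite (coord_free _ _ simple_free) eq_sym (negPf ji).
have lt_ht : ht b' < ht b.
  have -> : ht b' = ht b - 2 * dot b (alpha i) / dot (alpha i) (alpha i).
    rewrite /b' reflE /ht -[X in _ = _ - X]mulr1 -{3}ht_alpha /ht mulr_sumr.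
    rewrite -sumrB.
    by apply: eq_bigr => j _; rewrite linearB linearZ.
  by rewrite ltrBlDr ltrDl divr_gt0 ?mulr_gt0 ?root_dot_gt0 ?ltr0n.
have c'n : (\sum_j c' j < n)%N.
  by apply: leq_trans cn; rewrite -(ltr_nat R[i]) -!htE -b'E -bE.
have [s sE] := IH b' c' b'E b'Phi pb' c'n.
exists (i :: s ++ [:: i]); rewrite word_prod_cons word_prod_cat sE.
apply/lfunP => x; rewrite !comp_lfunE word_prodE refl_prod_cons comp_lfunE.
by rewrite refl_prod_nil -refl_conj // /b' reflK.
Qed.

Lemma weyl_has_word w : weyl D w -> exists s, wp s = w.
Proof.
move=> ww; elim/weyl_ind: w / ww => [|b w bPhi _ [s <-]].
  by exists [::]; rewrite /word_prod big_nil.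
have [t <-] := refl_is_word bPhi; exists (t ++ s); exact: word_prod_cat.
Qed.

(** * Length *)

Lemma weyl_length_word s : (len (wp s) <= size s)%N.
Proof.
have h : has_word D (wp s) (size s).
  by apply/existsP; exists (in_tuple s).
rewrite /weyl_length; case: pselect => [e|[]]; last by exists (size s).
by case: ex_minnP => n _; apply.
Qed.

Lemma weyl_reduced_word w : weyl D w -> exists s, reduced_word D s w.
Proof.
move=> /weyl_has_word[s sE].
have h : has_word D w (size s).
  by apply/existsP; exists (in_tuple s); rewrite /= sE.
rewrite /reduced_word /weyl_length; case: pselect => [e|[]]; last first.
  by exists (size s).
case: ex_minnP => n /existsP[t /eqP tE] _; exists t; by rewrite tE size_tuple.
Qed.

(** The exchange property: following the root [d] through the suffixes of the
    word, it turns positive at a simple reflection, which is the letter to be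
    deleted. *)
Lemma exchange s d : d \in Phi -> ~~ pos d -> pos (wp s d) ->
  exists2 t, (size t < size s)%N & wp t = (refl (wp s d) \o wp s)%VF.
Proof.
move=> dPhi nd; elim: s => [|i s IH].
  by rewrite /word_prod big_nil id_lfunE (negPf nd).
rewrite word_prod_cons comp_lfunE; set g := wp s d => pg.
have gPhi : g \in Phi by apply: weyl_root => //; apply: weyl_word.
have [/IH[t ts tE]|ng] := boolP (pos g).
  exists (i :: t) => //; rewrite word_prod_cons tE; apply/lfunP => x.
  by rewrite !comp_lfunE refl_conj // reflK.
have gi : g = - alpha i.
  apply/eqP; rewrite -eqr_oppLR; apply/negPn/negP => gi.
  have := simple_refl_pos (opp_root gPhi) _ gi; rewrite pos_opp // => /(_ ng).
  by rewrite linearN pos_opp ?refl_root // pg.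
exists s => //; have -> : refl (alpha i) g = alpha i.
  by rewrite gi linearN /= refl_self // opprK.
by rewrite reflKf.
Qed.

(** The exchange property shortens a reduced word of [w]. *)
Lemma refl_down w d : weyl D w -> d \in Phi -> pos (w d) -> ~~ pos d ->
  (len (refl (w d) \o w)%VF < len w)%N.
Proof.
move=> /weyl_reduced_word[s [<- sz]] dPhi pwd nd.
have [t ts <-] := exchange dPhi nd pwd.
by rewrite -sz; apply: leq_ltn_trans ts; apply: weyl_length_word.
Qed.

(** [refl (w d) \o w] sends [- d] to [w d], so [refl_down] applies to it. *)
Lemma refl_up w d : weyl D w -> d \in Phi -> pos (w d) -> pos d ->
  (len w < len (refl (w d) \o w)%VF)%N.
Proof.
move=> ww dPhi pwd pd; have wdPhi := weyl_root ww dPhi.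
pose w2 := (refl (w d) \o w)%VF.
have w2d : w2 (- d) = w d by rewrite comp_lfunE !linearN /= refl_self // opprK.
have := @refl_down w2 (- d); rewrite w2d reflKf //; apply=> //.
- exact: weyl_refl.
- exact: opp_root.
- by rewrite pos_opp ?negbK.
Qed.

Definition ascent i w := (len w < len (refl (alpha i) \o w)%VF)%N.

Lemma ascentE i w d : weyl D w -> d \in Phi -> w d = alpha i ->
  ascent i w = pos d.
Proof.
move=> ww dPhi wd; rewrite /ascent -wd.
have pwd : pos (w d) by rewrite wd alpha_pos.
have [pd|nd] := boolP (pos d); first by rewrite refl_up.
by apply/negbTE; rewrite -leqNgt ltnW // refl_down.
Qed.

Lemma ascent_refl i w : weyl D w ->
  ascent i (refl (alpha i) \o w)%VF = ~~ ascent i w.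
Proof.
move=> ww; have [d dPhi wd] := weyl_preimage ww (alpha_root i).
rewrite (ascentE ww dPhi wd) -pos_opp //; apply: ascentE.
- exact: weyl_refl.
- exact: opp_root.
- by rewrite comp_lfunE linearN /= wd linearN /= refl_self // opprK.
Qed.

Lemma len_simple_le i w : weyl D w ->
  (len (refl (alpha i) \o w)%VF <= (len w).+1)%N.
Proof.
move=> /weyl_reduced_word[s [<- sz]]; rewrite -word_prod_cons -sz.
exact: (weyl_length_word (i :: s)).
Qed.

Lemma len_ascent i w : weyl D w -> ascent i w ->
  len (refl (alpha i) \o w)%VF = (len w).+1.
Proof. by move=> ww aw; apply/eqP; rewrite eqn_leq len_simple_le. Qed.

(** * Bruhat order and the lifting property *)

Local Notation "u <=B w" := (bruhat D u w) (at level 70).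

Lemma bruhat_trans v u w : u <=B v -> v <=B w -> u <=B w.
Proof.
by move=> uv vw; elim: vw => // x b _ ux bPhi ltx; apply: bruhat_step.
Qed.

Lemma bruhat_weyl u w : u <=B w -> weyl D u -> weyl D w.
Proof. by elim=> // x b _ IH bPhi _ wu; apply: weyl_refl => //; apply: IH. Qed.

Lemma bruhat_ascent i w : ascent i w -> w <=B (refl (alpha i) \o w)%VF.
Proof. by move=> aw; apply: bruhat_step aw => //; apply: bruhat_refl. Qed.

Lemma bruhat_descent i w : weyl D w -> ~~ ascent i w ->
  (refl (alpha i) \o w)%VF <=B w.
Proof.
move=> ww nw; rewrite -{2}(reflKf w (alpha_root i)).
by apply: bruhat_ascent; rewrite ascent_refl.
Qed.

(** Left multiplication by a simple reflection carries the edge from [x] to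
    [refl b x] to another edge of the Bruhat graph, unless it only reverses it:
    [refl (alpha i)] keeps every positive root other than [alpha i] positive. *)
Lemma simple_edge i x b : weyl D x -> b \in Phi ->
  (len x < len (refl b \o x)%VF)%N ->
  (refl b \o x)%VF = (refl (alpha i) \o x)%VF \/
  forall u, u <=B (refl (alpha i) \o x)%VF ->
            u <=B (refl (alpha i) \o (refl b \o x))%VF.
Proof.
move=> wx; wlog pb : b / pos b => [posP bPhi|].
  case/orP: (pos_or_neg bPhi) => [|/posP]; first by move/posP; apply.
  by rewrite refl_opp; apply; exact: opp_root.
move=> bPhi ltx; have [->|b_i] := eqVneq b (alpha i); [by left | right => u ux].
have [d dPhi dE] := weyl_preimage wx bPhi.
have pd : pos d.
  apply/negPn/negP => nd; have := @refl_down x d wx dPhi.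
  by rewrite dE ltnNge ltnW // => /(_ pb nd).
pose sx := (refl (alpha i) \o x)%VF.
have sxd : sx d = refl (alpha i) b by rewrite comp_lfunE dE.
have -> : (refl (alpha i) \o (refl b \o x))%VF = (refl (sx d) \o sx)%VF.
  by apply/lfunP => y; rewrite sxd !comp_lfunE refl_conj // reflK.
apply: bruhat_step => //; first by rewrite sxd refl_root.
apply: refl_up => //; first exact: weyl_refl.
by rewrite sxd; apply: simple_refl_pos.
Qed.

(** The two lifting lemmas transport a Bruhat path through left
    multiplication by a simple reflection, edge by edge, with [simple_edge]. *)
Lemma bruhat_lift_left i u w : weyl D u -> u <=B w ->
  (refl (alpha i) \o u)%VF <=B w \/
  (refl (alpha i) \o u)%VF <=B (refl (alpha i) \o w)%VF.
Proof.
move=> wu; elim=> [|x b ux IH bPhi ltx]; first by right; apply: bruhat_refl.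
have wx := bruhat_weyl ux wu.
case: IH => sux; first by left; apply: bruhat_step.
by have [->|step] := simple_edge i wx bPhi ltx; [left | right; apply: step].
Qed.

Lemma bruhat_lift_right i u w : weyl D u -> u <=B w ->
  u <=B (refl (alpha i) \o w)%VF \/
  (refl (alpha i) \o u)%VF <=B (refl (alpha i) \o w)%VF.
Proof.
move=> wu; elim=> [|x b ux IH bPhi ltx]; first by right; apply: bruhat_refl.
have wx := bruhat_weyl ux wu.
have [->|step] := simple_edge i wx bPhi ltx; first by left; rewrite reflKf.
by case: IH => /step; [left | right].
Qed.

Lemma bruhat_simple_up i u w : weyl D u -> u <=B w -> ascent i w ->
  (refl (alpha i) \o u)%VF <=B (refl (alpha i) \o w)%VF.
Proof.
move=> wu uw aw; case: (bruhat_lift_left i wu uw) => // su_w.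
exact: bruhat_trans su_w (bruhat_ascent aw).
Qed.

Lemma bruhat_simple_down i u w : weyl D u -> u <=B w -> ~~ ascent i u ->
  (refl (alpha i) \o u)%VF <=B (refl (alpha i) \o w)%VF.
Proof.
move=> wu uw nu; case: (bruhat_lift_right i wu uw) => // u_sw.
exact: bruhat_trans (bruhat_descent wu nu) u_sw.
Qed.

Lemma bruhat_simple_mid i u w : weyl D u -> u <=B w -> ascent i u ->
  u <=B (refl (alpha i) \o w)%VF.
Proof.
move=> wu uw au; case: (bruhat_lift_right i wu uw) => // su_sw.
exact: bruhat_trans (bruhat_ascent au) su_sw.
Qed.

(** * Deleting letters from a word *)

(** The marked positions of [m] are those deleted. *)
Definition skip (m : bitseq) (s : seq index) : seq index := mask (map negb m) s.

(** The roots [beta s k] in the order of the positions [k], see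
    [inversions_beta].  When [s] is reduced they are the inversions of its
    product. *)
Fixpoint inversions (s : seq index) : seq V :=
  if s is i :: s'
  then alpha i :: map (refl (alpha i)) (inversions s') else [::].

Lemma size_inversions s : size (inversions s) = size s.
Proof. by elim: s => //= i s <-; rewrite size_map. Qed.

Lemma inversions_root s : {subset inversions s <= Phi}.
Proof.
elim: s => //= i s IH b; rewrite inE => /predU1P[->|/mapP[c /IH cPhi ->]] //.
exact: refl_root.
Qed.

Lemma mask_inversions_root m s : {subset mask m (inversions s) <= Phi}.
Proof. by move=> b /mem_mask; apply: inversions_root. Qed.

Lemma refl_prod_map a L x : a \in Phi ->
  refl_prod (map (refl a) L) x = refl a (refl_prod L (refl a x)).
Proof.
move=> aPhi; elim: L => [|b L IH] /=; first by rewrite !refl_prod_nil reflK.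
by rewrite !refl_prod_cons !comp_lfunE refl_conj // IH reflK.
Qed.

(** Deleting a letter of a word amounts to multiplying on the left by the
    reflection in the root attached to its position. *)
Lemma word_prod_skip m s : size m = size s ->
  wp (skip m s) = (refl_prod (mask m (inversions s)) \o wp s)%VF.
Proof.
elim: s m => [|i s IH] [|c m] //=.
  by move=> _; rewrite /refl_prod big_nil comp_lfun1l.
move=> [/IH {}IH]; apply/lfunP => x; rewrite -map_mask comp_lfunE.
case: c; rewrite /skip /= -/(skip m s).
  rewrite refl_prod_cons word_prod_cons IH !comp_lfunE.
  by rewrite refl_prod_map // !reflK.
by rewrite !word_prod_cons IH refl_prod_map // !comp_lfunE reflK.
Qed.

Definition mask_le (m P : bitseq) : bool := all2 implb m P.

Lemma mask_le_size m P : mask_le m P -> size m = size P.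
Proof. by rewrite /mask_le all2E => /andP[/eqP]. Qed.

Lemma mask_le_refl m : mask_le m m.
Proof. by elim: m => //= -[] m. Qed.

Lemma mask_le_false m : mask_le (nseq (size m) false) m.
Proof. by elim: m. Qed.

Lemma skip_false s : skip (nseq (size s) false) s = s.
Proof. by elim: s => //= i s IH; rewrite /skip /= -/(skip _ s) IH. Qed.

Lemma mask_le_subset (T : eqType) m P (L : seq T) : mask_le m P ->
  {subset mask m L <= mask P L}.
Proof.
elim: m P L => [|c m IH] [|p P] [|x L] //= /andP[cp mP] y.
have := IH P L mP y; case: c p cp => [] [] //= _ sub; rewrite ?inE.
  by move=> /predU1P[->|/sub ->]; rewrite ?eqxx ?orbT.
by move=> /sub ->; rewrite orbT.
Qed.

(** * Products of orthogonal reflections *)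

Definition orthogonal_roots : seq V -> bool :=
  pairwise (fun a b => dot a b == 0).

Lemma refl_prod_fix L x : {in L, forall b, dot x b = 0} -> refl_prod L x = x.
Proof.
elim: L => [|b L IH] xL; first by rewrite refl_prod_nil.
rewrite refl_prod_cons comp_lfunE IH; last first.
  by move=> c cL; rewrite xL ?inE ?cL ?orbT.
by rewrite refl_orth // xL ?mem_head.
Qed.

(** Each root is negated by its own reflection and fixed by all the others. *)
Lemma refl_prod_opp (L : seq V) x : {subset L <= Phi} -> orthogonal_roots L ->
  x \in <<L>>%VS -> refl_prod L x = - x.
Proof.
move=> LPhi oL; suff: (<<L>> <= lker (refl_prod L + \1%VF)%R)%VS.
  move=> /subvP sub /sub; rewrite memv_ker add_lfunE id_lfunE addr_eq0.
  by move/eqP.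
apply/span_subvP => b bL; rewrite memv_ker add_lfunE id_lfunE addr_eq0.
apply/eqP; elim: L => [//|a L IH] in LPhi oL bL *.
move: oL; rewrite /= => /andP[/allP aL oL].
have aPhi : a \in Phi by rewrite LPhi ?mem_head.
have LPhi' : {subset L <= Phi} by move=> c cL; rewrite LPhi // inE cL orbT.
rewrite refl_prod_cons comp_lfunE; move: bL; rewrite inE => /predU1P[->|bL].
  by rewrite refl_prod_fix ?refl_self // => c /aL /eqP.
by rewrite IH // linearN /= refl_orth // dotC; apply/eqP/aL.
Qed.

Lemma refl_prod_span L x : refl_prod L x - x \in <<L>>%VS.
Proof.
elim: L => [|b L IH]; first by rewrite refl_prod_nil subrr mem0v.
rewrite refl_prod_cons comp_lfunE reflE addrAC span_cons addrC -scaleNr.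
by rewrite memv_add ?rpredZ ?memv_line.
Qed.

(** * Boolean intervals *)

(** Products of reflections in [L] move vectors by elements of the span of [L].
    Writing [alpha i] as [refl_prod L1 y], both [alpha i] and its image
    [- alpha i] differ from [y] by such elements, so [alpha i] is in the span,
    on which [refl_prod L] is [-1]. *)
Lemma refl_prod_opp_simple i (L L1 L2 : seq V) w :
  weyl D w -> {subset L <= Phi} ->
  {subset L1 <= L} -> {subset L2 <= L} -> orthogonal_roots L ->
  (refl (alpha i) \o (refl_prod L1 \o w))%VF = (refl_prod L2 \o w)%VF ->
  refl_prod L (alpha i) = - alpha i.
Proof.
move=> ww LPhi L1L L2L oL eqL; apply: refl_prod_opp => //.
have span_sub (K : seq V) : {subset K <= L} -> (<<K>> <= <<L>>)%VS.
  by move=> KL; apply/span_subvP => x /KL /memv_span.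
have wL1 : weyl D (refl_prod L1) by apply: weyl_refl_prod => x /L1L /LPhi.
have [y ym] := weyl_surj (alpha i) wL1.
have [z zy] := weyl_surj y ww.
have /lfunP/(_ z) := eqL; rewrite !comp_lfunE zy ym refl_self // => ym'.
have am : alpha i - y \in <<L>>%VS.
  by rewrite -{1}ym (subvP (span_sub _ L1L)) ?refl_prod_span.
have am' : - alpha i - y \in <<L>>%VS.
  by rewrite ym' (subvP (span_sub _ L2L)) ?refl_prod_span.
have : 2^-1 *: ((alpha i - y) - (- alpha i - y)) \in <<L>>%VS.
  by rewrite rpredZ // rpredB.
have -> : alpha i - y - (- alpha i - y) = 2%:R *: alpha i.
  by rewrite opprB opprK addrA subrK scaler_nat mulr2n.
by rewrite scalerA mulVf ?pnatr_eq0 // scale1r.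
Qed.

Lemma orthogonal_roots_map a L : a \in Phi ->
  orthogonal_roots (map (refl a) L) = orthogonal_roots L.
Proof.
move=> aPhi; rewrite /orthogonal_roots pairwise_map.
by apply: eq_pairwise => x y /=; rewrite refl_isometry.
Qed.

Definition reduced s := len (wp s) == size s.

Lemma reduced_tail i s : reduced (i :: s) -> reduced s /\ ascent i (wp s).
Proof.
rewrite /reduced /ascent word_prod_cons /= => /eqP sz.
have := len_simple_le i (weyl_word s); rewrite sz ltnS => le_s.
have := weyl_length_word s => ge_s.
by rewrite eqn_leq ge_s le_s ltnS.
Qed.

Lemma reduced_cons i s : reduced s -> ascent i (wp s) -> reduced (i :: s).
Proof.
rewrite /reduced word_prod_cons /= => /eqP <- /len_ascent -> //.
exact: weyl_word.
Qed.

Section BooleanInterval.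

Variables (s : seq index) (P : bitseq).
Hypothesis sizeP : size P = size s.
Hypothesis orthP : orthogonal_roots (mask P (inversions s)).

(** If equality held, [alpha i] would be negated by
    [refl_prod (mask P (inversions s))], so that [wp s] and [wp (skip P s)]
    would send opposite roots to [alpha i]; one of the two would be a
    descent. *)
Lemma no_simple_edge i m m' : mask_le m P -> mask_le m' P ->
  ascent i (wp s) -> ascent i (wp (skip P s)) ->
  (refl (alpha i) \o wp (skip m s))%VF <> wp (skip m' s).
Proof.
move=> mP m'P aw av eq_m.
have wws := weyl_word s.
have [d dPhi wd] := weyl_preimage wws (alpha_root i).
have pd : pos d by rewrite -(ascentE wws dPhi wd).
suff vd : wp (skip P s) (- d) = alpha i.
  by move: av; rewrite (ascentE (weyl_word _) (opp_root dPhi) vd) pos_opp // pd.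
rewrite word_prod_skip // comp_lfunE linearN /= wd linearN /=.
rewrite (@refl_prod_opp_simple i _ (mask m (inversions s))
           (mask m' (inversions s)) (wp s)) ?opprK //.
- exact: mask_inversions_root.
- exact: mask_le_subset.
- exact: mask_le_subset.
- by rewrite -!word_prod_skip // -sizeP; apply: mask_le_size.
Qed.

End BooleanInterval.

Lemma bruhat_le_id w : bruhat D w \1%VF -> w = \1%VF.
Proof.
have len1 : len \1%VF = 0%N.
  apply/eqP; rewrite -leqn0; have := weyl_length_word [::].
  by rewrite /word_prod big_nil.
by case E : _ / => [//|x b _ _ ltx]; move: ltx; rewrite -E len1.
Qed.

(** In terms of words and masks, so that the induction can remove the first
    letter. *)
Lemma boolean_interval s P : size P = size s ->
  reduced s -> reduced (skip P s) -> orthogonal_roots (mask P (inversions s)) ->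
  (forall x, bruhat_interval D (wp (skip P s)) (wp s) x ->
     exists2 m, mask_le m P & x = wp (skip m s)) /\
  (forall m m', mask_le m P -> mask_le m' P ->
     bruhat D (wp (skip m s)) (wp (skip m' s)) <-> mask_le m' m).
Proof.
elim: s P => [|i s IH] [|p P] //=.
  move=> _ _ _ _; split=> [x [_ _]|[|??] [|??] // _ _].
  - rewrite {1}/word_prod big_nil => /bruhat_le_id ->.
    by exists [::]; rewrite // /word_prod big_nil.
  - by split=> // _; apply: bruhat_refl.
move=> [szP] /reduced_tail[rs aw] rv oP.
have wwp m := weyl_word (skip m s).
have skipE c m : skip (c :: m) (i :: s) = if c then skip m s else i :: skip m s.
  by case: c.
have oP' : orthogonal_roots (mask P (inversions s)).
  rewrite -(orthogonal_roots_map _ (alpha_root i)) map_mask.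
  by case: p oP {rv} => [/andP[]|].
have rv' : reduced (skip P s).
  by move: rv; rewrite skipE; case: p {oP} => // /reduced_tail[].
have {IH} [sur ord] := IH P szP rs rv' oP'.
have refl_refl w := reflKf w (alpha_root i).
have lower m : mask_le m P -> bruhat D (wp (skip P s)) (wp (skip m s)).
  by move=> mP; apply/(ord P m) => //; apply: mask_le_refl.
have upper m : mask_le m P -> bruhat D (wp (skip m s)) (wp s).
  move=> mP; rewrite -{2}[s]skip_false -szP -(mask_le_size mP).
  apply/ord => //; last exact: mask_le_false.
  by rewrite (mask_le_size mP) mask_le_false.
(* If [p] holds, [alpha i] is orthogonal to the roots of the positions in
   [P], so [wp (skip m s)] and [wp s] send the same root to it. Otherwise a
   descent from [wp (skip m s)] would stay above [wp (skip P s)] by lifting,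
   giving an edge excluded by [no_simple_edge]. *)
have asc m : mask_le m P -> ascent i (wp (skip m s)).
  move=> mP; case: p oP rv => [oP _|_ rv].
    have [d dPhi wd] := weyl_preimage (weyl_word s) (alpha_root i).
    rewrite (ascentE (wwp m) dPhi) -?(ascentE (weyl_word s) dPhi wd) //.
    rewrite word_prod_skip ?(mask_le_size mP) // comp_lfunE wd refl_prod_fix //.
    move=> b /(mask_le_subset mP) bP; move: oP => /= /andP[/allP oP _].
    suff : dot (refl (alpha i) (alpha i)) b == 0.
      by rewrite refl_self // linearNl oppr_eq0 => /eqP.
    by rewrite refl_dot //; apply: oP; rewrite -map_mask map_f.
  have av : ascent i (wp (skip P s)) by case: (reduced_tail rv).
  apply/negPn/negP => nm.
  have [|m' m'P E] := sur (refl (alpha i) \o wp (skip m s))%VF.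
    split; first exact: weyl_refl.
      by apply: bruhat_simple_mid => //; apply: lower.
    exact: bruhat_trans (bruhat_descent (wwp m) nm) (upper m mP).
  exact: (no_simple_edge szP oP' mP m'P aw av E).
split=> [x|].
- rewrite skipE word_prod_cons; case: p {rv} oP => oP [wx vx xw].
  + have ascv := asc P (mask_le_refl P).
    have [ax|nx] := boolP (ascent i x).
      have [|m mP xE] := sur x; last by exists (true :: m).
      split=> //; rewrite -[wp s]refl_refl.
      exact: bruhat_simple_mid.
    have [|m mP xE] := sur (refl (alpha i) \o x)%VF.
      split; first exact: weyl_refl.
        exact: bruhat_simple_mid.
      rewrite -[wp s]refl_refl; exact: bruhat_simple_down.
    by exists (false :: m); rewrite // skipE word_prod_cons -xE refl_refl.
  + have av := asc P (mask_le_refl P).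
    have wsv : weyl D (refl (alpha i) \o wp (skip P s))%VF by apply: weyl_refl.
    have nsv : ~~ ascent i (refl (alpha i) \o wp (skip P s))%VF.
      by rewrite ascent_refl ?negbK.
    move: vx; rewrite word_prod_cons => vx.
    (* An ascent [x] would put the lower end of the interval, which is one step
       above [wp (skip P s)], inside the smaller interval. *)
    have [ax|nx] := boolP (ascent i x).
      have x_s : bruhat D x (wp s).
        by rewrite -[wp s]refl_refl; apply: bruhat_simple_mid.
      have [|m mP E] := sur (refl (alpha i) \o wp (skip P s))%VF.
        split=> //; first exact: bruhat_ascent.
        exact: bruhat_trans vx x_s.
      by case: (no_simple_edge szP oP' (mask_le_refl P) mP aw av E).
    have [|m mP xE] := sur (refl (alpha i) \o x)%VF.
      split; first exact: weyl_refl.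
        by rewrite -[wp (skip P s)]refl_refl; apply: bruhat_simple_down.
      rewrite -[wp s]refl_refl; exact: bruhat_simple_down.
    by exists (false :: m); rewrite // skipE word_prod_cons -xE refl_refl.
move=> [|c m] [|c' m'] //= /andP[cp mP] /andP[c'p m'P]; rewrite !skipE.
have ordm := ord m m' mP m'P.
have asm := asc m mP; have asm' := asc m' m'P.
have nsm : ~~ ascent i (refl (alpha i) \o wp (skip m s))%VF.
  by rewrite ascent_refl ?negbK.
have wsm : weyl D (refl (alpha i) \o wp (skip m s))%VF by apply: weyl_refl.
case: c cp => _; case: c' c'p => _ //=; rewrite ?word_prod_cons.
- rewrite -ordm; split=> le_m; last first.
    exact: bruhat_trans le_m (bruhat_ascent asm').
  by rewrite -[wp (skip m' s)]refl_refl; apply: bruhat_simple_mid.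
- split=> // le_m; exfalso.
  have [|m2 m2P E] := sur (refl (alpha i) \o wp (skip m s))%VF.
    split=> //; first exact: bruhat_trans (lower m mP) (bruhat_ascent asm).
    exact: bruhat_trans le_m (upper m' m'P).
  exact: (no_simple_edge szP oP' mP m2P aw (asc P (mask_le_refl P)) E).
- rewrite -ordm; split=> le_m; last exact: bruhat_simple_up.
  rewrite -[wp (skip m s)]refl_refl -[wp (skip m' s)]refl_refl.
  exact: bruhat_simple_down.
Qed.

(** * Orthogonality from the dimension of the [-1]-eigenspace *)

(** Subtracting from [x] successive multiples of independent vectors gives
    back [x] only if all the multiples vanish. *)
Lemma refl_prod_free_fix L x : {subset L <= Phi} -> free L ->
  refl_prod L x = x -> {in L, forall b, dot x b = 0}.
Proof.
elim: L => [//|a L IH] LPhi; rewrite free_cons => /andP[aL fL].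
have aPhi : a \in Phi by rewrite LPhi ?mem_head.
have LPhi' : {subset L <= Phi} by move=> c cL; rewrite LPhi // inE cL orbT.
rewrite refl_prod_cons comp_lfunE => Tx.
have Lx : refl_prod L x = refl a x by rewrite -{2}Tx reflK.
have xa : dot x a = 0.
  have := refl_prod_span L x; rewrite Lx reflE addrC addKr -scaleNr.
  apply: contraTeq => xa.
  rewrite rpredZeq (negPf aL) orbF oppr_eq0.
  rewrite mulf_neq0 ?invr_neq0 ?root_dot_neq0 //.
  by rewrite mulf_neq0 ?pnatr_eq0.
rewrite refl_orth // in Lx.
by move=> b; rewrite inE => /predU1P[->//|]; apply: IH.
Qed.

(** Peeling off the first reflection, the rest of the product fixes its root
    [a], which is therefore orthogonal to all the other roots; then [refl a]
    fixes those, and the rest of the product still negates them. *)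
Lemma free_opp_orthogonal L : {subset L <= Phi} -> free L ->
  {in L, forall b, refl_prod L b = - b} -> orthogonal_roots L.
Proof.
elim: L => [//|a L IH] LPhi; rewrite free_cons => /andP[aL fL] Lopp.
have aPhi : a \in Phi by rewrite LPhi ?mem_head.
have LPhi' : {subset L <= Phi} by move=> c cL; rewrite LPhi // inE cL orbT.
have Lopp' b : b \in a :: L -> refl_prod L b = - refl a b.
  by move=> bL; rewrite -linearN /= -Lopp // refl_prod_cons comp_lfunE reflK.
have aorth : {in L, forall b, dot a b = 0}.
  apply: refl_prod_free_fix => //.
  by rewrite Lopp' ?mem_head // refl_self // opprK.
rewrite /orthogonal_roots /=; apply/andP; split.
  by apply/allP => b /aorth ->.
apply: IH => // b bL; rewrite Lopp' ?inE ?bL ?orbT // refl_orth // dotC.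
exact: aorth.
Qed.

(** The [-1]-eigenspace of a product of [size L] reflections lies in the span of
    their roots, so if its dimension is [size L] it is that span. *)
Lemma orthogonal_of_dim L : {subset L <= Phi} ->
  \dim (lker (refl_prod L + \1%VF)%R) = size L -> orthogonal_roots L.
Proof.
move=> LPhi dimL; set K := lker _ in dimL.
have KL : (K <= <<L>>)%VS.
  apply/subvP => x; rewrite memv_ker add_lfunE id_lfunE addr_eq0 => /eqP Lx.
  have := refl_prod_span L x; rewrite Lx -opprD memvN -mulr2n -scaler_nat.
  by rewrite rpredZeq pnatr_eq0.
have dimS := dim_span L.
have fL : free L by rewrite /free eqn_leq dimS -dimL dimvS.
have /eqP KE : K == <<L>>%VS by rewrite eqEdim KL dimL dimS.
apply: free_opp_orthogonal => // b /memv_span; rewrite -KE memv_ker.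
by rewrite add_lfunE id_lfunE addr_eq0 => /eqP.
Qed.

(** The subword property, by induction on the word: lifting decides whether the
    first letter is kept or deleted. *)
Lemma subword u s : weyl D u -> reduced s -> bruhat D u (wp s) ->
  exists m, [/\ size m = size s, u = wp (skip m s) & reduced (skip m s)].
Proof.
elim: s u => [|i s IH] u wu.
  move=> r0; rewrite {1}/word_prod big_nil => /bruhat_le_id ->.
  by exists [::]; rewrite // /word_prod big_nil.
move=> /reduced_tail[rs aw] u_is.
have [au|nu] := boolP (ascent i u).
  have [|m [sz uE r]] := IH u wu rs.
    rewrite -[wp s](reflKf _ (alpha_root i)) -word_prod_cons.
    exact: bruhat_simple_mid.
  by exists (true :: m); rewrite /= sz.
have wsu : weyl D (refl (alpha i) \o u)%VF by apply: weyl_refl.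
have [|m [sz uE r]] := IH (refl (alpha i) \o u)%VF wsu rs.
  rewrite -[wp s](reflKf _ (alpha_root i)) -word_prod_cons.
  exact: bruhat_simple_down.
have uE' : u = (refl (alpha i) \o wp (skip m s))%VF by rewrite -uE reflKf.
exists (false :: m); split; first by rewrite /= sz.
  by rewrite /skip /= -/(skip m s) word_prod_cons.
apply: reduced_cons => //; rewrite -/(skip m s) -uE ascent_refl //.
Qed.

(** * Sets of positions *)

Lemma enum_set_sorted l (A : {set 'I_l}) : sorted ltn (map val (enum A)).
Proof.
rewrite sorted_map {1}/enum_mem; apply: sorted_filter.
  by move=> x y z; apply: ltn_trans.
by rewrite -enumT -sorted_map val_enum_ord iota_ltn_sorted.
Qed.

Definition set_mask l (A : {set 'I_l}) : bitseq :=
  [seq k \in A | k <- enum 'I_l].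

Lemma size_set_mask l (A : {set 'I_l}) : size (set_mask A) = l.
Proof. by rewrite size_map size_enum_ord. Qed.

Lemma set_mask0 l : set_mask (set0 : {set 'I_l}) = nseq l false.
Proof.
rewrite -[in RHS](size_enum_ord l) /set_mask.
by elim: (enum 'I_l) => //= k e ->; rewrite in_set0.
Qed.

Lemma mask_set_mask l (A : {set 'I_l}) : mask (set_mask A) (enum 'I_l) = enum A.
Proof. by rewrite -filter_mask enumT. Qed.

Lemma set_mask_nth l m : size m = l ->
  m = set_mask [set k : 'I_l | nth false m k].
Proof.
move=> sz; rewrite /set_mask; apply: (@eq_from_nth _ false).
  by rewrite size_map size_enum_ord.
move=> k; rewrite sz => kl; rewrite (nth_map (Ordinal kl)) ?size_enum_ord //.
by rewrite inE nth_enum_ord.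
Qed.

Lemma mask_le_set l (A B : {set 'I_l}) :
  mask_le (set_mask A) (set_mask B) = (A \subset B).
Proof.
have all2_map (e : seq 'I_l) (f g : pred 'I_l) :
    all2 implb (map f e) (map g e) = all (fun k => f k ==> g k) e.
  by elim: e => //= k e ->.
rewrite /mask_le all2_map; apply/allP/subsetP => AB k.
  by have := AB k; rewrite mem_enum => /(_ isT)/implyP.
by move=> _; apply/implyP/AB.
Qed.

Lemma inversions_beta l (s : l.-tuple index) :
  inversions s = [seq beta D s k | k <- enum 'I_l].
Proof.
have nthE (i0 : index) t k : (k < size t)%N ->
    nth 0 (inversions t) k = wp (take k t) (alpha (nth i0 t k)).
  elim: t k => //= i t IH [|k] kt; first by rewrite /word_prod big_nil id_lfunE.
  by rewrite /= (nth_map 0) ?size_inversions //= word_prod_cons comp_lfunE IH.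
apply: (@eq_from_nth _ 0).
  by rewrite size_inversions size_map size_enum_ord size_tuple.
move=> k; rewrite size_inversions size_tuple => kl.
rewrite (nth_map (Ordinal kl)) ?size_enum_ord //.
have -> : nth (Ordinal kl) (enum 'I_l) k = Ordinal kl.
  exact: (nth_ord_enum _ (Ordinal kl)).
pose i0 := tnth s (Ordinal kl).
by rewrite (nthE i0) ?size_tuple // /beta (tnth_nth i0).
Qed.

Lemma mask_inversions l (s : l.-tuple index) (A : {set 'I_l}) :
  mask (set_mask A) (inversions s) = [seq beta D s k | k <- enum A].
Proof. by rewrite inversions_beta -map_mask mask_set_mask. Qed.

Lemma delete_skip l (s : l.-tuple index) (A : {set 'I_l}) :
  delete s A = skip (set_mask A) s.
Proof.
rewrite /delete /skip -[in RHS](map_tnth_enum s) -map_mask -mask_set_mask.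
rewrite /set_mask -map_comp; congr (map _ (mask _ _)).
by apply: eq_map => k; rewrite /= inE.
Qed.

Section Positions.

Variables (l d : nat) (s : l.-tuple index) (p : 'I_d -> 'I_l).
Hypothesis p_incr : {homo p : j k / (j < k)%N}.

Let p_inj : injective p.
Proof.
move=> j k pjk; apply/val_inj/eqP; rewrite eqn_leq.
by apply/andP; split; rewrite leqNgt; apply/negP => /p_incr; rewrite pjk ltnn.
Qed.

Lemma enum_imset (K : {set 'I_d}) : enum (p @: K) = map p (enum K).
Proof.
apply: (inj_map val_inj); apply: (irr_sorted_eq ltn_trans ltnn).
- exact: enum_set_sorted.
- rewrite -map_comp; have := enum_set_sorted K; rewrite !sorted_map.
  by apply: sub_sorted => j k; apply: p_incr.
- move=> x; apply/mapP/mapP => -[k kE ->]; exists k => //.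
    by move: kE; rewrite mem_enum => /imsetP[j jK ->]; rewrite map_f ?mem_enum.
  by move: kE => /mapP[j jK ->]; rewrite mem_enum imset_f // -mem_enum.
Qed.

Lemma w_sub_skip (K : {set 'I_d}) :
  w_sub D (wp s) s p K = wp (skip (set_mask (p @: K)) s).
Proof.
rewrite word_prod_skip ?size_set_mask ?size_tuple // mask_inversions enum_imset.
rewrite -map_comp /w_sub /refl_prod big_map.
by rewrite -big_filter [index_enum _]unlock.
Qed.

Lemma orthogonal_roots_beta :
  (forall j k, j != k -> dot (beta D s (p j)) (beta D s (p k)) = 0) ->
  orthogonal_roots (mask (set_mask (p @: setT)) (inversions s)).
Proof.
move=> orth; rewrite mask_inversions enum_imset -map_comp.
rewrite /orthogonal_roots pairwise_map; have := enum_uniq [set: 'I_d].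
rewrite uniq_pairwise; apply: sub_pairwise => j k /= jk.
by rewrite orth.
Qed.

Lemma mask_le_imset m : mask_le m (set_mask (p @: setT)) ->
  exists K : {set 'I_d}, m = set_mask (p @: K).
Proof.
move=> mP; have sz := mask_le_size mP; rewrite size_set_mask in sz.
move: mP; rewrite (set_mask_nth sz) mask_le_set; set A := [set k | _] => AP.
exists (p @^-1: A); congr set_mask; apply/setP => k; apply/idP/imsetP => [kA|].
  have /imsetP[j _ kE] := subsetP AP k kA.
  by exists j; rewrite // inE -kE.
by case=> j jA ->; rewrite inE in jA.
Qed.

Lemma imset_ord : [set p j | j : 'I_d] = p @: setT.
Proof. by apply/setP => k; apply/imsetP/imsetP => -[j _ ->]; exists j. Qed.

Lemma imset_subset (J K : {set 'I_d}) : (p @: J \subset p @: K) = (J \subset K).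
Proof.
apply/subsetP/subsetP => JK x; last first.
  by case/imsetP=> j /JK jK ->; apply: imset_f.
by move=> xJ; have := JK _ (imset_f p xJ); rewrite mem_imset.
Qed.

End Positions.

Lemma ECR_positions_boolean v w l d (s : l.-tuple index) (p : 'I_d -> 'I_l) :
  ECR_positions D v w s p ->
  [/\ forall K, bruhat_interval D v w (w_sub D w s p K),
      forall x, bruhat_interval D v w x ->
         exists K : {set 'I_d}, x = w_sub D w s p K &
      forall K J : {set 'I_d},
         bruhat D (w_sub D w s p K) (w_sub D w s p J) <-> J \subset K].
Proof.
case=> [[<- sw] p_incr [vE sv] orth].
rewrite imset_ord delete_skip in vE sv.
have rs : reduced s by rewrite /reduced sw.
have rv : reduced (skip (set_mask (p @: setT)) s) by rewrite /reduced vE -sv.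
have szP : size (set_mask (p @: setT)) = size s.
  by rewrite size_set_mask size_tuple.
have [sur ord] :=
  boolean_interval szP rs rv (orthogonal_roots_beta p_incr orth).
have le_P (K : {set 'I_d}) : mask_le (set_mask (p @: K)) (set_mask (p @: setT)).
  by rewrite mask_le_set imset_subset ?subsetT.
have ordK (K J : {set 'I_d}) :
    bruhat D (w_sub D (wp s) s p K) (w_sub D (wp s) s p J) <-> J \subset K.
  by rewrite !w_sub_skip // ord ?le_P // mask_le_set imset_subset.
split=> //.
- move=> K; split.
  + by rewrite w_sub_skip //; apply: weyl_word.
  + rewrite -vE -(w_sub_skip s p_incr); exact/ordK/subsetT.
  + rewrite -[X in bruhat D _ (wp X)]skip_false size_tuple -set_mask0.
    by rewrite -(imset0 p) -(w_sub_skip s p_incr); apply/ordK/sub0set.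
- move=> x; rewrite -vE => /sur[m /mask_le_imset[K ->] ->].
  by exists K; rewrite w_sub_skip.
Qed.

(** The positions are those deleted in a reduced subword for [v]; their roots
    are orthogonal by the dimension condition in the definition of [ECR]. *)
Lemma ECR_positions_exist v w : ECR D v w ->
  exists l (s : l.-tuple index) (p : 'I_(len w - len v) -> 'I_l),
    ECR_positions D v w s p.
Proof.
case=> wv ww vw dimK.
have [s [sE sz]] := weyl_reduced_word ww.
have rs : reduced s by rewrite /reduced sE sz.
have v_s : bruhat D v (wp s) by rewrite sE.
have [m [szm vE rm]] := subword wv rs v_s.
pose P := [set k : 'I_(size s) | nth false m k].
pose t := in_tuple s.
have mP : m = set_mask P by apply: set_mask_nth.
have cardP : (len w - len v)%N = #|P|.
  have -> : len v = #|~: P|.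
    by move/eqP: rm; rewrite -vE mP -(delete_skip t) /delete size_map -cardE.
  rewrite [#|~: P|]cardsCs setCK card_ord -sz subKn //.
  by rewrite -[X in (_ <= X)%N]card_ord max_card.
pose p j := @enum_val _ (mem P) (cast_ord cardP j).
have p_incr : {homo p : j k / (j < k)%N}.
  move=> j k jk; pose x0 := p j.
  rewrite /p !(enum_val_nth x0) -!(nth_map x0 (val x0) val) -?cardE ?ltn_ord //.
  apply: (sorted_ltn_nth ltn_trans) => //.
  - exact: enum_set_sorted.
  - by rewrite inE size_map -cardE ltn_ord.
  - by rewrite inE size_map -cardE ltn_ord.
have pP : [set p j | j : 'I_(len w - len v)] = P.
  apply/setP => k; apply/imsetP/idP => [[j _ ->]|kP]; first exact: enum_valP.
  exists (cast_ord (esym cardP) (enum_rank_in kP k)) => //.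
  by rewrite /p cast_ordKV enum_rankK_in.
have orth : orthogonal_roots (mask m (inversions s)).
  apply: orthogonal_of_dim; first exact: mask_inversions_root.
  have kw : lker w == 0%VS by apply/lker0P; apply: weyl_inj.
  have vwE : (v \o w^-1)%VF = refl_prod (mask m (inversions s)).
    by rewrite vE word_prod_skip // sE lker0_compfK.
  move: dimK; rewrite vwE => ->.
  by rewrite cardP mP (mask_inversions t) size_map -cardE.
exists (size s), t, p; split=> //.
  by rewrite pP delete_skip -mP; split=> //; rewrite vE; apply/esym/eqP.
have imP : P = p @: setT by rewrite -pP imset_ord.
have orth_lt (j k : 'I_(len w - len v)) : (j < k)%N ->
    dot (beta D t (p j)) (beta D t (p k)) = 0.
  have eT : enum setT = enum 'I_(len w - len v) by rewrite enum_setT enumT.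
  move=> jk; have /(pairwiseP (beta D t (p j))) := orth.
  rewrite mP (mask_inversions t) imP (enum_imset p_incr) -map_comp.
  rewrite eT size_map size_enum_ord => /(_ j k (ltn_ord j) (ltn_ord k) jk).
  rewrite (nth_map j) ?size_enum_ord; last exact: ltn_ord.
  rewrite (nth_map j) ?size_enum_ord; last exact: ltn_ord.
  by rewrite !nth_ord_enum => /eqP.
move=> j k; case: (ltngtP j k) => [jk|jk|/val_inj->]; last by rewrite eqxx.
  by move=> _; apply: orth_lt.
by move=> _; rewrite dotC; apply: orth_lt.
Qed.

End RootSystem.

Theorem theorem4p10 (R : realType) (V : vectType R[i]) (D : based_root_system V)
    (v w : 'End(V)) (d : nat) (hvw : ECR D v w)
    (hd : d = (weyl_length D w - weyl_length D v)%N) :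
  (exists f : {set 'I_d} -> 'End(V),
      poset_iso (fun K J : {set 'I_d} => J \subset K) (bruhat D)
        (bruhat_interval D v w) f) /\
  (forall (l : nat) (s : l.-tuple 'I_(\dim {:V})) (p : 'I_d -> 'I_l),
      ECR_positions D v w s p ->
      (forall x, bruhat_interval D v w x ->
         exists K : {set 'I_d}, x = w_sub D w s p K) /\
      (forall K J : {set 'I_d},
         bruhat D (w_sub D w s p K) (w_sub D w s p J) <-> J \subset K)).
Proof.
subst d; split; last first.
  by move=> l s p /ECR_positions_boolean[_ sur ord].
have [l [s [p sp]]] := ECR_positions_exist hvw.
have [sub sur ord] := ECR_positions_boolean sp.
exists (w_sub D w s p); split=> [K J eqKJ|x|K J]; last by rewrite ord.
- apply/eqP; rewrite eqEsubset; apply/andP.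
  by split; apply/ord; rewrite eqKJ; apply: bruhat_refl.
- by split=> [/sur[K ->]|[K <-]]; first by exists K.
Qed.
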